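(* Suppose that $\mathbb X$ is a Hilbert space and $\|\cdot\|$ is the norm induced by its inner product. Let $\{x_i\}_{i\in\mathbb N}$ be an orthonormal family in $\mathbb X$ with dense linear span, and let $\|\cdot\|_{\mathfrak R}=\|\cdot\|_{\ell_2}$ on $\mathbb R^n$. Let $x^\star$ be an optimizer of $(\mathcal P)$, $y_n^\star$ an optimizer of $(\mathcal D_n)$, and choose $\theta_{\mathcal P}\ge\|x^\star\|$. Assume that $(\mathcal P_n)$ is feasible and that there is $\gamma>0$ with $\|\mathcal A_n^*y\|_{\mathfrak R^*}\ge\gamma\|y\|_*$ for all $y\in\mathbb K^*$ and $\gamma\theta_{\mathcal P}>\|b\|$. Then $$0\le J_n-J\le\big(\|c\|_{*n}+\theta_{\mathcal D}\|\mathcal A\|_n\big)\,\big\|\Pi_{\overline{\mathbb X}_n}(x^\star)\big\|,$$ where $\overline{\mathbb X}_n$ is the orthogonal complement of $\mathbb X_n:=\mathrm{span}\{x_1,\dots,x_n\}$, $\Pi_{\overline{\mathbb X}_n}$ is the orthogonal projection onto it, $$\|c\|_{*n}:=\sup_{0\ne x\in\overline{\mathbb X}_n}\frac{\langle x,c\rangle}{\|x\|},\qquad \|\mathcal A\|_n:=\sup_{0\ne x\in\overline{\mathbb X}_n}\frac{\|\mathcal Ax\|}{\|x\|},\qquad \theta_{\mathcal D}:=\frac{\theta_{\mathcal P}\|\mathbf c\|_{\mathfrak R^*}-J_n^{\rm LB}}{\gamma\theta_{\mathcal P}-\|b\|},$$ and $J_n^{\rm LB}\le J_n$ is any lower bo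und.
   Context: Dual pairs: $\mathbb X,\mathbb C$ are real vector spaces with a bilinear form $\langle\cdot,\cdot\rangle$ on $\mathbb X\times\mathbb C$ separating points on both sides; $\mathbb X$ carries a norm $\|\cdot\|$, which induces the dual norm $\|c\|_*:=\sup_{\|x\|\le1}\langle x,c\rangle$ on $\mathbb C$. $(\mathbb B,\mathbb Y,\|\cdot\|)$ is another such dual pair (same notation). $\mathcal A:\mathbb X\to\mathbb B$ is linear and continuous with respect to the weak topologies (the weakest topologies for which the topological duals of $\mathbb X$, $\mathbb B$ are $\mathbb C$, $\mathbb Y$). $\mathbb K\subset\mathbb B$ is a convex cone, closed in the weak topology, with dual cone $\mathbb K^*:=\{y\in\mathbb Y:\langle z,y\rangle\ge0\ \forall z\in\mathbb K\}$. $c\in\mathbb C$, $b\in\mathbb B$ are fixed; $z\succeq_{\mathbb K}b$ means $z-b\in\mathbb K$. $(\mathcal P)$: $J:=\inf\{\langle x,c\rangle:\ x\in\mathbb X,\ \mathcal Ax\succeq_{\mathbb K}b\}$, assumed to have an optimizer. For $n\in\mathbb N$, a norm $\|\cdot\|_{\mathfrak R}$ on $\mathbb R^n$ with dual norm $\|\cdot\|_{\mathfrak R^*}$, and $\theta_{\mathcal P}>0$, define $\mathcal A_n\alpha:=\sum_{i=1}^n\alpha_i\mathcal Ax_i$, $\mathcal A_n^*y:=[\langle\mathcal Ax_1,y\rangle,\dots,\langle\mathcal Ax_n,y\rangle]$, $\mathbf c:=[\langle x_1,c\rangle,\dots,\langle x_n,c\rangle]$; $\alpha\cdot\beta$ is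 the standard inner product. $(\mathcal P_n)$: $J_n:=\inf\{\alpha\cdot\mathbf c:\ \alpha\in\mathbb R^n,\ \mathcal A_n\alpha\succeq_{\mathbb K}b,\ \|\alpha\|_{\mathfrak R}\le\theta_{\mathcal P}\}$. $(\mathcal D_n)$: $\sup\{\langle b,y\rangle-\theta_{\mathcal P}\|\mathcal A_n^*y-\mathbf c\|_{\mathfrak R^*}:\ y\in\mathbb K^*\}$. *)

(* Defs.v *)
From HB Require Import structures.
From mathcomp Require Import all_boot all_order all_algebra.
From mathcomp Require Import sesquilinear.
From mathcomp Require Import all_classical all_reals all_analysis.

Set Implicit Arguments.
Unset Strict Implicit.
Unset Printing Implicit Defensive.

Import Order.TTheory GRing.Theory Num.Theory.
Import numFieldNormedType.Exports.

Local Open Scope classical_set_scope.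
Local Open Scope ring_scope.

Notation "{ 'pairing' X , C }" := {bilinear X -> C -> _ | *%R & *%R}
  (at level 0, X at level 98, C at level 98,
   format "{ 'pairing'  X ,  C }") : ring_scope.

Section DualPairs.
Context {R : realType} {X : normedModType R} {C : lmodType R}.
Variable pair : {pairing X, C}.

Definition separating : Prop :=
  (forall x, (forall c, pair x c = 0) -> x = 0) /\
  (forall c, (forall x, pair x c = 0) -> c = 0).

(* Extended-real valued: nothing forces <., c> to be norm-bounded. *)
Definition dual_norm (c : C) : \bar R :=
  ereal_sup [set (pair x c)%:E | x in [set x : X | `|x| <= 1]].

(* sigma(X, C), the coarsest topology making every <., c> continuous; the
   topology of X as a normedModType is the norm topology instead. *)
Definition weak_space : topologicalType :=
  sup_topology (fun c : C =>
    Topological.class (initial_topology (fun x : X => pair x c : R^o))).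

Definition dual_cone (K : set X) : set C :=
  [set y | forall z, K z -> 0 <= pair z y].

End DualPairs.

Definition convex_cone (R : realType) (V : lmodType R) (K : set V) : Prop :=
  (forall (t : R) z, 0 <= t -> K z -> K (t *: z)) /\
  convex_set (K : set (convex_lmodType V)).

Section InnerProduct.
Context {R : realType} {X : normedModType R}.
Variable ip : {dot X for (idfun : R -> R)}.

Definition norm_induced_by : Prop := forall u, `|u| = Num.sqrt (ip u u).

Definition orthonormal_family (x : nat -> X) : Prop :=
  forall i j, ip (x i) (x j) = (i == j)%:R.

Definition orth_compl (V : set X) : set X :=
  [set u | forall v, V v -> ip v u = 0].

Definition orth_proj (V : set X) (u : X) : X :=
  xget 0 [set p | V p /\ forall v, V v -> ip v (u - p) = 0].

End InnerProduct.

Definition lin_span (R : realType) (X : lmodType R) (S : set X) : set X :=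
  [set v | exists (m : nat) (a : 'I_m -> R) (u : 'I_m -> X),
     (forall i, S (u i)) /\ v = \sum_(i < m) a i *: u i].

(* With families indexed from 0, this is span {x_0, ..., x_(n-1)}. *)
Definition head_span (R : realType) (X : lmodType R) (x : nat -> X) (n : nat) :
  set X := lin_span (x @` [set i : nat | (i < n)%N]).

Section FiniteVectors.
Context {R : realType} {n : nat}.

Definition vdot (a b : 'rV[R]_n) : R := \sum_(i < n) a 0 i * b 0 i.

Definition l2norm (a : 'rV[R]_n) : R := Num.sqrt (\sum_(i < n) a 0 i ^+ 2).

Definition vdual_norm (N : 'rV[R]_n -> R) (b : 'rV[R]_n) : R :=
  sup [set vdot a b | a in [set a | N a <= 1]].

End FiniteVectors.

Section Programs.
Context {R : realType} {X B : normedModType R} {C Y : lmodType R}.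
Variables (pX : {pairing X, C}) (pB : {pairing B, Y}).
Variables (A : {linear X -> B}) (K : set B) (c : C) (b : B).

Definition P_feasible : set X := [set x | K (A x - b)].

Definition P_value : \bar R := ereal_inf [set (pX x c)%:E | x in P_feasible].

Definition P_optimizer (x : X) : Prop :=
  P_feasible x /\ (pX x c)%:E = P_value.

Variables (x : nat -> X) (n : nat) (N : 'rV[R]_n -> R) (theta : R).

Definition A_n (a : 'rV[R]_n) : B := \sum_(i < n) a 0 i *: A (x i).

Definition A_n_adj (y : Y) : 'rV[R]_n := \row_(i < n) pB (A (x i)) y.

Definition c_vec : 'rV[R]_n := \row_(i < n) pX (x i) c.

Definition Pn_feasible : set 'rV[R]_n :=
  [set a | K (A_n a - b) /\ N a <= theta].

Definition Pn_value : \bar R :=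
  ereal_inf [set (vdot a c_vec)%:E | a in Pn_feasible].

Definition Dn_objective (y : Y) : R :=
  pB b y - theta * vdual_norm N (A_n_adj y - c_vec).

Definition Dn_value : \bar R :=
  ereal_sup [set (Dn_objective y)%:E | y in dual_cone pB K].

Definition Dn_optimizer (y : Y) : Prop :=
  dual_cone pB K y /\ (Dn_objective y)%:E = Dn_value.

End Programs.

Section RestrictedNorms.
Context {R : realType} {X B : normedModType R} {C : lmodType R}.

Definition dual_norm_on (pX : {pairing X, C}) (V : set X) (c : C) : \bar R :=
  ereal_sup [set (pX u c / `|u|)%:E | u in V `\ 0].

Definition op_norm_on (A : {linear X -> B}) (V : set X) : \bar R :=
  ereal_sup [set (`|A u| / `|u|)%:E | u in V `\ 0].

End RestrictedNorms.

(* Main.v *)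
Require Import Defs.
From HB Require Import structures.
From mathcomp Require Import all_boot all_order all_algebra.
From mathcomp Require Import sesquilinear.
From mathcomp Require Import all_classical all_reals all_analysis.
From mathcomp Require Import ring lra.

Import Order.TTheory GRing.Theory Num.Theory.
Import numFieldNormedType.Exports.

Local Open Scope classical_set_scope.
Local Open Scope ring_scope.

(** A point feasible for [(P_n)] is feasible for [(P)], whence [J <= J_n]. For
    the upper bound, strong duality [J_n <= sup (D_n)] holds: the cone is weakly
    closed, so each infeasible point is cut off by some [y] of the dual cone,
    finitely many cuts suffice on the compact ball [||alpha|| <= theta_P], and
    separation in [R^m] merges them into a single multiplier. Split the optimizer
    as [xstar = p + q] with [p] in the span of the first [n] basis vectors. By
    Bessel, the coordinates of [p] lie in the ball, so comparing them with the
    objective of [(D_n)] at [ystar] leaves the gap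
    [- <q, c> + <A q, ystar>]. The coercivity assumption bounds the dual norm of
    [ystar] by [theta_D]. *)

(** * Euclidean row vectors: compactness, separation and the dual norm *)

Section FiniteDimension.
Context {R : realType} {n : nat}.
Implicit Types (a b u v : 'rV[R]_n) (S : set 'rV[R]_n).

Lemma vdotC a b : vdot a b = vdot b a.
Proof. by apply: eq_bigr => i _; rewrite mulrC. Qed.

Lemma vdotDl a b v : vdot (a + b) v = vdot a v + vdot b v.
Proof.
by rewrite /vdot -big_split; apply: eq_bigr => i _; rewrite mxE mulrDl.
Qed.

Lemma vdotZl (t : R) a v : vdot (t *: a) v = t * vdot a v.
Proof. by rewrite /vdot mulr_sumr; apply: eq_bigr => i _; rewrite mxE mulrA. Qed.

Lemma vdotBl a b v : vdot (a - b) v = vdot a v - vdot b v.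
Proof. by rewrite -scaleN1r vdotDl vdotZl mulN1r. Qed.

Lemma vdotDr a b v : vdot v (a + b) = vdot v a + vdot v b.
Proof. by rewrite vdotC vdotDl !(vdotC _ v). Qed.

Lemma vdotZr (t : R) a v : vdot v (t *: a) = t * vdot v a.
Proof. by rewrite vdotC vdotZl vdotC. Qed.

Lemma vdotBr a b v : vdot v (a - b) = vdot v a - vdot v b.
Proof. by rewrite vdotC vdotBl !(vdotC _ v). Qed.

Lemma vdot_ge_sqr a i : a 0 i ^+ 2 <= vdot a a.
Proof.
rewrite /vdot (bigD1 i) //= -expr2 lerDl.
by apply: sumr_ge0 => j _; rewrite -expr2 sqr_ge0.
Qed.

Lemma continuous_sum_ord (T : topologicalType) m (f : 'I_m -> T -> R) :
  (forall i, continuous (f i)) -> continuous (fun x => \sum_(i < m) f i x).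
Proof.
by move=> cf x; apply: cvg_big => [|i _]; [exact: add_continuous|exact: cf].
Qed.

Lemma vdot_continuousl b : continuous (fun a => vdot a b).
Proof.
by apply: continuous_sum_ord => i a; apply: continuousM;
  [exact: coord_continuous|exact: cst_continuous].
Qed.

Lemma vdot_diag_continuous : continuous (fun a => vdot a a).
Proof.
by apply: continuous_sum_ord => i a; apply: continuousM; exact: coord_continuous.
Qed.

Lemma l2normE a : l2norm a = Num.sqrt (vdot a a).
Proof. by congr Num.sqrt; apply: eq_bigr => i _; rewrite expr2. Qed.

Lemma l2norm_le (r : R) a : 0 <= r -> (l2norm a <= r) = (vdot a a <= r ^+ 2).
Proof.
by move=> r0; rewrite l2normE -[r in LHS](ger0_norm r0) -sqrtr_sqr ler_sqrt ?sqr_ge0.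
Qed.

Lemma l2normZ (t : R) a : l2norm (t *: a) = `|t| * l2norm a.
Proof. by rewrite !l2normE vdotZl vdotZr mulrA -expr2 sqrtrM ?sqr_ge0 // sqrtr_sqr. Qed.

Lemma vdot_sublevel_compact S (r : R) :
  closed S -> compact (S `&` [set a | vdot a a <= r]).
Proof.
move=> cS; apply: bounded_closed_compact.
  (* The norm here is the max norm, so a bound on each entry suffices. Since [r + 1] squared exceeds
     every [r >= 0], this radius avoids a square root. *)
  exists (r + 1); split; first exact: num_real.
  move=> M rM a [_ /= ar]; rewrite [leLHS]/Num.norm /= mx_normrE.
  have M0 : 0 <= M.
    have : 0 <= vdot a a by apply: sumr_ge0 => i _; rewrite -expr2 sqr_ge0.
    lra.
  apply/bigmax_leP; split => //= -[i j] _ /=; rewrite ord1.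
  have := le_trans (vdot_ge_sqr a j) ar; rewrite -real_normK ?num_real //.
  have := normr_ge0 (a 0 j); nra.
apply: closedI => //.
apply: (@preimage_closed _ _ (fun a : 'rV[R]_n => vdot a a) [set s | s <= r]).
  by move=> a _; exact: vdot_diag_continuous.
exact: closed_le.
Qed.

Lemma l2ball_compact (r : R) : 0 <= r -> compact [set a : 'rV[R]_n | l2norm a <= r].
Proof.
move=> r0; rewrite (_ : mkset _ = setT `&` [set a | vdot a a <= r ^+ 2]).
  by apply: vdot_sublevel_compact; exact: closedT.
by rewrite setTI; apply/seteqP; split => a /=; rewrite l2norm_le.
Qed.

(** The convexity defect of the squared norm is exactly [t * (1 - t) * vdot (a - b) (a - b)], which
    is nonnegative. *)
Lemma l2ball_convex (r t : R) a b : 0 <= t <= 1 ->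
  l2norm a <= r -> l2norm b <= r -> l2norm (t *: a + (1 - t) *: b) <= r.
Proof.
move=> /andP[t0 t1] ar br.
have r0 : 0 <= r by apply: le_trans ar; rewrite sqrtr_ge0.
move: ar br; rewrite !l2norm_le //.
have : 0 <= vdot (a - b) (a - b) by apply: sumr_ge0 => i _; rewrite -expr2 sqr_ge0.
rewrite !(vdotBl, vdotBr, vdotDl, vdotDr, vdotZl, vdotZr) (vdotC b a).
have : 0 <= t * (1 - t) by rewrite mulr_ge0 // subr_ge0.
set x := vdot a a; set y := vdot a b; set z := vdot b b.
move=> tt; move/(mulr_ge0 tt) => h hx hz.
have h1 : t * x <= t * r ^+ 2 by rewrite ler_wpM2l.
have h2 : (1 - t) * z <= (1 - t) * r ^+ 2 by rewrite ler_wpM2l // subr_ge0.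
lra.
Qed.

(* The normal vector is the point of the closure of [S] nearest to the origin. *)
Lemma convex_separation S (e : R) : 0 < e ->
  (forall u v (t : R), S u -> S v -> 0 <= t <= 1 -> S (t *: u + (1 - t) *: v)) ->
  (forall u, S u -> e <= vdot u u) ->
  exists l, forall u, S u -> 0 < vdot l u.
Proof.
move=> e0 Sconv Se.
have [[s0 Ss0]|S0] := pselect (S !=set0); last first.
  by exists 0 => u Su; exfalso; apply: S0; exists u.
(* Cutting the closure at the level of one point [s0] makes it compact without changing the
   minimum. *)
pose D := closure S `&` [set a | vdot a a <= vdot s0 s0].
have D0 : D !=set0 by exists s0; split => /=; [exact: subset_closure|].
have cD : compact D by apply: vdot_sublevel_compact; exact: closed_closure.
have [v vD vmin] : exists2 v, v \in D & forall w, w \in D -> vdot v v <= vdot w w.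
  apply: (@EVT_min_rV R n (fun a => vdot a a) D) => //.
  by apply: continuous_subspaceT; exact: vdot_diag_continuous.
have {vD} [Sv vs0] := set_mem vD.
have {}vmin w : S w -> vdot v v <= vdot w w.
  move=> Sw; have [ws0|/ltW/(le_trans _)] := leP (vdot w w) (vdot s0 s0); last exact.
  by apply: vmin; apply/mem_set; split => //; exact: subset_closure.
have closureE (f : 'rV[R]_n -> R) (r : R) : continuous f ->
    (forall w, S w -> r <= f w) -> r <= f v.
  move=> cf Sf.
  have /closure_id cl : closed [set w | r <= f w].
    apply: (@preimage_closed _ _ f [set s | r <= s]); last exact: closed_ge.
    by move=> w _; exact: cf.
  have : closure [set w | r <= f w] v by apply: closureS Sv.
  by rewrite -cl.
have vv : e <= vdot v v by apply: closureE Se; exact: vdot_diag_continuous.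
exists v => u Su.
(* As [v] is only a limit of points of [S], the inequality is proved for segments from [u] to [w] in
   [S] and carried to [w = v] by continuity. *)
have step (t : R) : 0 <= t <= 1 ->
    vdot v v <= vdot (t *: u + (1 - t) *: v) (t *: u + (1 - t) *: v).
  move=> t01; pose h w := t *: u + (1 - t) *: w.
  apply: (closureE (fun w => vdot (h w) (h w))).
    move=> w; apply: (@continuous_comp _ _ _ h (fun w => vdot w w)).
      apply: continuousD; first exact: cst_continuous.
      apply: (@continuousZ _ _ _ (fun=> 1 - t) id); last exact: cvg_id.
      exact: cst_continuous.
    exact: vdot_diag_continuous.
  by move=> w Sw; apply: vmin; exact: Sconv.
rewrite ltNge; apply/negP => uv0.
have uu : 0 <= vdot u u by apply: sumr_ge0 => i _; rewrite -expr2 sqr_ge0.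
(* This [t] minimizes [t ^+ 2 * vdot u u + (1 - t) ^+ 2 * vdot v v]. The minimum is
   [(1 - t) * vdot v v], strictly below [vdot v v], which contradicts [step] when
   [vdot v u <= 0]. *)
pose t := vdot v v / (vdot u u + vdot v v).
have den : 0 < vdot u u + vdot v v by lra.
have td : t * (vdot u u + vdot v v) = vdot v v by rewrite /t divfK ?gt_eqF.
have t0 : 0 < t by rewrite divr_gt0 //; lra.
have t1 : t <= 1 by rewrite ler_pdivrMr //; lra.
have := step t; rewrite (ltW t0) t1 => /(_ isT).
rewrite !(vdotDl, vdotDr, vdotZl, vdotZr) (vdotC u v).
have h1 : t * (1 - t) * vdot v u <= 0.
  by rewrite mulr_ge0_le0 // mulr_ge0 ?subr_ge0 // ltW.
have h2 : 0 < t * vdot v v by rewrite mulr_gt0 //; lra.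
have h3 : t * (t * (vdot u u + vdot v v)) = t * vdot v v by rewrite td.
lra.
Qed.

Lemma vdual_norm_has_sup b :
  has_sup [set vdot a b | a in [set a | l2norm a <= 1]].
Proof.
split.
  by exists (vdot 0 b), 0 => //=; rewrite -(scale0r 0) l2normZ normr0 mul0r.
exists (\sum_(i < n) `|b 0 i|) => _ [a /= a1 <-]; apply: ler_sum => i _.
apply: le_trans (ler_norm _) _; rewrite normrM -[leRHS]mul1r ler_wpM2r //.
move: a1; rewrite l2norm_le // expr1n => /(le_trans (vdot_ge_sqr a i)).
by rewrite -real_normK ?num_real // expr_le1.
Qed.

Lemma vdot_le_vdual_norm (r : R) a b : 0 < r -> l2norm a <= r ->
  vdot a b <= r * vdual_norm (@l2norm R n) b.
Proof.
move=> r0 ar; rewrite -(ler_pdivrMl _ _ r0) -vdotZl.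
apply: ub_le_sup; first exact: (vdual_norm_has_sup b).2.
exists (r^-1 *: a) => //=.
by rewrite l2normZ ger0_norm ?invr_ge0 ?(ltW r0) // ler_pdivrMl // mulr1.
Qed.

Lemma vdual_norm_le (r : R) b :
  (forall a, l2norm a <= 1 -> vdot a b <= r) -> vdual_norm (@l2norm R n) b <= r.
Proof.
move=> br; apply: ge_sup; first exact: (vdual_norm_has_sup b).1.
by move=> _ [a /= a1 <-]; exact: br.
Qed.

Lemma vdual_normB b v :
  vdual_norm (@l2norm R n) b <=
    vdual_norm (@l2norm R n) (b - v) + vdual_norm (@l2norm R n) v.
Proof.
apply: vdual_norm_le => a a1; rewrite -[b in leLHS](subrK v) vdotDr.
by rewrite lerD // -[leRHS]mul1r vdot_le_vdual_norm.
Qed.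

End FiniteDimension.

(** * Separating a point from a weakly closed convex cone *)

Section Bipolar.
Context {R : realType} {B : normedModType R} {Y : lmodType R}.
Variable pB : {pairing B, Y}.

(** Reduces weak closedness to finitely many functionals, so that separation can take place in a
    finite-dimensional space. *)
Lemma weak_closed_nbhs (K : set B) z : @closed (weak_space pB) K -> ~ K z ->
  exists (ys : seq Y) (e : R), 0 < e /\
    forall w, (forall y, y \in ys -> `|pB z y - pB w y| < e) -> ~ K w.
Proof.
move=> clK Kz.
(* [F] is generated by the finite boxes around [z]. Convergence in a supremum topology is checked
   one functional at a time, and then the open complement of [K] must belong to [F]. *)
pose F : set_system B := [set A | exists (ys : seq Y) (e : R), 0 < e /\
  forall w, (forall y, y \in ys -> `|pB z y - pB w y| < e) -> A w].
have FF : Filter F.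
  split=> [|P Q [ys [e [e0 eP]]] [ys' [e' [e'0 eQ]]]|P Q PQ [ys [e [e0 eP]]]].
  - by exists [::], 1.
  - exists (ys ++ ys'), (Num.min e e'); split; first by rewrite lt_min e0.
    move=> w wz; split; [apply: eP|apply: eQ] => y yin.
      by have := wz y; rewrite mem_cat yin lt_min => /(_ isT)/andP[].
    by have := wz y; rewrite mem_cat yin orbT lt_min => /(_ isT)/andP[].
  - by exists ys, e; split => // w /eP /PQ.
have Fz : F --> (z : weak_space pB).
  apply/cvg_sup => y A [_ [[U oU <-] Uz] UA].
  have [e /= e0 eU] : nbhs_ball (pB z y : R^o) U.
    by apply/nbhs_ballP; exact: open_nbhs_nbhs.
  exists [:: y], e; split => // w wz; apply: UA; apply: eU.
  by apply: wz; rewrite mem_seq1.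
apply: (Fz (~` K)); apply: open_nbhs_nbhs; split => //.
exact: closed_openC.
Qed.

Lemma convex_coneD (K : set B) u v : convex_cone K -> K u -> K v -> K (u + v).
Proof.
move=> [Kcone Kconv] Ku Kv.
have h0 : (0 : R) <= 2^-1 by rewrite invr_ge0.
have h1 : (2^-1 : R) <= 1 by rewrite invf_le1 // ler1n.
have h : K (2^-1 *: u + (1 - 2^-1) *: v).
  exact: set_mem (Kconv u v (Itv01 h0 h1) (mem_set Ku) (mem_set Kv)).
rewrite (_ : u + v = 2 *: (2^-1 *: u + (1 - 2^-1) *: v)); first exact: Kcone.
rewrite scalerDr !scalerA mulrBr mulr1 divff ?pnatr_eq0 // scale1r.
by rewrite (_ : 2 - 1 = 1 :> R) ?scale1r //; lra.
Qed.

(** Finitely many functionals map [K - z] to a convex set at distance at least [e] from the origin.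
    A separating vector, read as coefficients of these functionals, gives [y] with [pB z y < pB k y]
    on all of [K]; the cone structure turns this into the two sign conditions. *)
Lemma bipolar (K : set B) z : convex_cone K -> @closed (weak_space pB) K ->
  K !=set0 -> ~ K z -> exists2 y, dual_cone pB K y & pB z y < 0.
Proof.
move=> cK clK [k0 Kk0] /(weak_closed_nbhs _ _ clK)[ys [e [e0 eK]]].
pose T w : 'rV[R]_(size ys) := \row_j pB w ys`_j.
have [|u v t /= [k Kk <-] [k' Kk' <-] /andP[t0 t1]|_ [k Kk <-]|l lT] :=
    @convex_separation R (size ys) [set T (k - z) | k in K] (e ^+ 2).
- by rewrite exprn_gt0.
- exists (t *: k + (1 - t) *: k').
    by apply: convex_coneD => //; apply: cK.1 => //; rewrite subr_ge0.
  apply/rowP => j; rewrite !mxE !linearBl linearDl !linearZl_LR /=; ring.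
- have [j ej] : exists j : 'I_(size ys), e <= `|T (k - z) 0 j|.
    apply: contrapT => /forallNP ltj; apply: (eK k) => // y /(nthP 0)[j jlt <-].
    rewrite distrC ltNge; apply/negP => ej; apply: (ltj (Ordinal jlt)).
    by rewrite mxE linearBl.
  apply: le_trans (vdot_ge_sqr _ j); rewrite -[leRHS]real_normK ?num_real //.
  by rewrite ler_sqr ?nnegrE // ltW.
pose y := \sum_(j < size ys) l 0 j *: ys`_j.
have yT w : vdot l (T w) = pB w y.
  rewrite linear_sumr; apply: eq_bigr => j _.
  by rewrite mxE linearZr_LR.
have Kzy k : K k -> pB z y < pB k y.
  by move=> Kk; rewrite -subr_gt0 -linearBl -yT; apply: lT; exists k.
have K0 : K 0 by rewrite -(scale0r k0); exact: cK.1.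
exists y; last by have := Kzy _ K0; rewrite linear0l.
move=> k Kk; rewrite leNgt; apply/negP => ky.
(* If [pB k y] were negative, rescaling [k] by this ratio would give a point of [K] at which [y]
   takes the value [pB z y], against strict separation. *)
have q0 : 0 <= pB z y / pB k y.
  have := Kzy _ K0; rewrite linear0l => zy.
  by rewrite -mulrNN -invrN mulr_ge0 ?invr_ge0 // oppr_ge0 ltW.
by have := Kzy _ (cK.1 _ _ q0 Kk); rewrite linearZl_LR /= divfK ?lt_eqF // ltxx.
Qed.

End Bipolar.

(** A theorem of the alternative: compactness selects finitely many of the [f i], and separation
    merges them into one nonnegative combination. The level [-1], rather than [0], supplies the
    uniform margin that separation requires. *)
Lemma affine_alternative (R : realType) (n : nat) (I : choiceType) (D : set I)
    (f : I -> 'rV[R]_n -> R) (Q : set 'rV[R]_n) :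
  Q !=set0 -> compact Q ->
  (forall a b (t : R), 0 <= t <= 1 -> Q a -> Q b -> Q (t *: a + (1 - t) *: b)) ->
  (forall i, continuous (f i)) ->
  (forall i a b (t : R), f i (t *: a + (1 - t) *: b) = t * f i a + (1 - t) * f i b) ->
  (forall a, Q a -> exists2 i, D i & f i a < -1) ->
  exists (m : nat) (s : 'I_m -> I) (l : 'I_m -> R),
    [/\ forall j, D (s j), forall j, 0 <= l j &
        forall a, Q a -> \sum_(j < m) l j * f (s j) a < 0].
Proof.
move=> [a0 Qa0] Qcomp Qconv fcont faff Qf.
move: Qcomp; rewrite compact_cover => /(_ I D (fun i => [set a | f i a < -1])).
case=> [i _|a /Qf[i Di fi]|D' D'D QD'].
- apply: (@open_comp _ _ (f i) [set s | s < -1]); last exact: open_lt.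
  by move=> a _; exact: fcont.
- by exists i.
pose s := tnth (in_tuple (finmap.enum_fset D')).
(* Taking all vectors above the image of [- f], not just the image, is what forces the separating
   vector to have nonnegative entries. *)
pose S : set 'rV[R]_(size (finmap.enum_fset D')) :=
  [set u | exists2 a, Q a & forall j, - f (s j) a <= u 0 j].
have [//|u v t [a Qa ua] [b Qb vb] /andP[t0 t1]|u [a Qa ua]|l lS] :=
    convex_separation S 1.
- exists (t *: a + (1 - t) *: b); first by apply: Qconv => //; rewrite t0.
  move=> j; rewrite faff !mxE opprD -!mulrN lerD // ler_wpM2l // subr_ge0 //.
- have [i /= iD' fi] := QD' _ Qa.
  have [j ij] : exists j, i = s j by apply/tnthP.
  apply: le_trans (vdot_ge_sqr _ j); have := ua j; rewrite -ij; nra.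
have SF a : Q a -> S (\row_j - f (s j) a) by exists a => // j; rewrite mxE.
have lF a : vdot l (\row_j - f (s j) a) = - \sum_j l 0 j * f (s j) a.
  by rewrite -sumrN; apply: eq_bigr => j _; rewrite mxE mulrN.
exists (size (finmap.enum_fset D')), s, (fun j => l 0 j); split.
- by move=> j; apply/set_mem; apply: D'D; exact: mem_tnth.
- move=> j; rewrite leNgt; apply/negP => lj.
  have d0 := lS _ (SF _ Qa0); set d := vdot l _ in d0.
  (* With [l 0 j < 0], this upward move along coordinate [j] stays in [S] but brings the separating
     functional exactly to [0]. *)
  have : S (\row_j - f (s j) a0 + (- d / l 0 j) *: delta_mx 0 j).
    exists a0 => // k; rewrite !mxE lerDl mulr_ge0 //.
    by rewrite -mulrNN opprK -invrN mulr_ge0 ?invr_ge0 ?oppr_ge0 // ltW.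
  move=> /lS; rewrite vdotDr vdotZr -/d.
  rewrite (_ : vdot l _ = l 0 j) ?divfK ?lt_eqF ?subrr ?ltxx //.
  rewrite /vdot (bigD1 j) //= big1 => [|k kj]; first by rewrite mxE !eqxx mulr1 addr0.
  by rewrite mxE (negbTE kj) andbF mulr0.
- by move=> a Qa; rewrite -oppr_gt0 -lF; exact: lS (SF _ Qa).
Qed.

(** * Strong duality for the finite-dimensional program *)

Section StrongDuality.
Context {R : realType} {X B : normedModType R} {C Y : lmodType R}.
Variables (pX : {pairing X, C}) (pB : {pairing B, Y}).
Variables (A : {linear X -> B}) (K : set B) (c : C) (b : B).
Variables (x : nat -> X) (n : nat) (theta : R).

Lemma pairing_A_n (a : 'rV[R]_n) y :
  pB (A_n A x a) y = vdot a (A_n_adj pB A x n y).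
Proof.
rewrite linear_sumlz; apply: eq_bigr => i _.
by rewrite linearZl_LR mxE.
Qed.

(** No point of the ball both satisfies the cone constraint and has objective at most [r]. The
    alternative turns this into multipliers [(y, q)], and dividing by [q] makes the Lagrangian
    exceed [r] on the whole ball; its infimum there is the dual objective. *)
Lemma Dn_strong_duality (r : R) : convex_cone K -> @closed (weak_space pB) K ->
  0 < theta -> Pn_feasible A K b x (@l2norm R n) theta !=set0 ->
  (forall a, Pn_feasible A K b x (@l2norm R n) theta a ->
     r < vdot a (c_vec pX c x n)) ->
  exists2 y, dual_cone pB K y &
    r <= Dn_objective pX pB A c b x (@l2norm R n) theta y.
Proof.
move=> cK clK theta0 [a0 [Ka0 a0theta]] rP.
pose cv := c_vec pX c x n.
(* Minus the Lagrangian shifted by [r], with multiplier [p.1] for the cone and [p.2] for the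
   objective, arranged so that it is visibly affine in [a]; [fE] gives the readable form. *)
pose f (p : Y * R) (a : 'rV[R]_n) :=
  vdot a (A_n_adj pB A x n p.1 - p.2 *: cv) + (p.2 * r - pB b p.1).
pose D := [set p : Y * R | dual_cone pB K p.1 /\ 0 <= p.2].
have fE p a : f p a = pB (A_n A x a - b) p.1 + p.2 * (r - vdot a cv).
  by rewrite linearBl pairing_A_n /f vdotBr vdotZr; ring.
have [||||||m [s [l [sD l0 sf]]]] :=
    affine_alternative R n _ D f [set a | l2norm a <= theta].
- by exists a0.
- exact: l2ball_compact (ltW theta0).
- by move=> a a' t; exact: l2ball_convex.
- move=> p a; apply: (@continuousD _ _ _ (fun a => vdot a _) (fun=> _)).
    exact: vdot_continuousl.
  exact: cst_continuous.
- by move=> p a a' t; rewrite /f !vdotDl !vdotZl; ring.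
- move=> a /= atheta.
  have [Ka|nKa] := pselect (K (A_n A x a - b)).
    have ra : r < vdot a cv by exact: rP.
    (* The factor is chosen so that [f] equals [-2], below the level [-1]; the infeasible case below
       is scaled likewise. *)
    exists (0, 2 / (vdot a cv - r)).
      split=> /=; first by move=> z _; rewrite linear0r.
      by rewrite divr_ge0 // subr_ge0 ltW.
    rewrite fE /= linear0r add0r -[r - _]opprB mulrN ltrN2.
    by rewrite divfK ?ltr1n // subr_eq0 gt_eqF.
  have [y Ky yneg] := bipolar _ _ _ cK clK (ex_intro _ _ Ka0) nKa.
  exists ((2 / - pB (A_n A x a - b) y) *: y, 0).
    split=> //= z Kz; rewrite linearZr_LR /= mulr_ge0 ?Ky //.
    by rewrite divr_ge0 // oppr_ge0 ltW.
  rewrite fE /= mul0r addr0 linearZr_LR /= -ltrN2 opprK -mulrN divfK ?ltr1n //.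
  by rewrite oppr_eq0 lt_eqF.
pose y := \sum_(j < m) l j *: (s j).1.
pose q := \sum_(j < m) l j * (s j).2.
have Ky : dual_cone pB K y.
  move=> z Kz; rewrite linear_sumr; apply: sumr_ge0 => j _.
  by rewrite linearZr_LR /= mulr_ge0 //; apply: (sD j).1.
have yqneg a : l2norm a <= theta -> pB (A_n A x a - b) y + q * (r - vdot a cv) < 0.
  move=> /sf; congr (_ < _); rewrite linear_sumr mulr_suml -big_split.
  by apply: eq_bigr => j _; rewrite fE linearZr_LR /= mulrDr mulrA.
(* If [q] vanished, [y] would be negative at [A_n A x a0 - b], which lies in [K]. Feasibility thus
   excludes a degenerate multiplier. *)
have q0 : 0 < q.
  have qge0 : 0 <= q by apply: sumr_ge0 => j _; rewrite mulr_ge0 //; apply: (sD j).2.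
  rewrite lt_neqAle qge0 andbT; apply/eqP => qE.
  by have := yqneg _ a0theta; rewrite -qE mul0r addr0 ltNge Ky.
exists (q^-1 *: y).
  by move=> z Kz; rewrite linearZr_LR /= mulr_ge0 ?invr_ge0 ?(ltW q0) ?Ky.
rewrite /Dn_objective lerBrDr -lerBrDl -ler_pdivlMl //.
apply: vdual_norm_le => a a1; rewrite ler_pdivlMl // -vdotZl.
(* Testing at [theta *: a] for [a] in the unit ball produces the factor [theta] in front of the dual
   norm. *)
have ta : l2norm (theta *: a) <= theta.
  by rewrite l2normZ gtr0_norm // -[leRHS]mulr1 ler_wpM2l // ltW.
have := yqneg _ ta; rewrite vdotBr -pairing_A_n !linearZr_LR /= linearBl -/cv.
set u := pB _ y; set v := pB b y; set w := vdot _ _ => h.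
rewrite -(ler_pM2l q0) mulrBr mulrBr !mulrA divff ?gt_eqF // !mul1r; lra.
Qed.

End StrongDuality.

(** * Orthogonal projections and Bessel's inequality *)

Section OrthogonalProjection.
Context {R : realType} {X : normedModType R}.
Variables (ip : {dot X for (idfun : R -> R)}) (x : nat -> X).

Lemma dot_sym u v : ip u v = ip v u.
Proof. by rewrite hermC expr0 mul1r. Qed.

Lemma dotBr w u v : ip w (u - v) = ip w u - ip w v.
Proof. exact: linearBr. Qed.

Lemma dotBl w u v : ip (u - v) w = ip u w - ip v w.
Proof. exact: linearBl. Qed.

Lemma dot_eq0 u : ip u u = 0 -> u = 0.
Proof.
move=> u0; apply/eqP; apply: contraTT isT => /(neq0_dnorm_gt0 (s := ip)).
by rewrite u0 ltxx.
Qed.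

Definition head_coords (n : nat) (u : X) : 'rV[R]_n := \row_(i < n) ip (x i) u.

Definition head_proj (n : nat) (u : X) : X :=
  \sum_(i < n) head_coords n u 0 i *: x i.

Hypothesis x_orth : orthonormal_family ip x.

Lemma dot_head_proj n u i : (i < n)%N -> ip (x i) (head_proj n u) = ip (x i) u.
Proof.
move=> ilt; rewrite /head_proj linear_sumr (bigD1 (Ordinal ilt)) //= big1 ?addr0.
  by rewrite linearZr_LR /= x_orth eqxx mulr1 mxE.
move=> j ji; rewrite linearZr_LR /= x_orth.
suff /negbTE -> : i != j :> nat by rewrite mulr0.
by apply: contraNneq ji => ij; apply/eqP/val_inj.
Qed.

Lemma head_proj_span n u : head_span x n (head_proj n u).
Proof.
exists n, (fun i => head_coords n u 0 i), (fun i => x i); split => // i.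
by exists (val i) => //=.
Qed.

Lemma sub_head_proj_orth n u : orth_compl ip (head_span x n) (u - head_proj n u).
Proof.
move=> _ [m [a [w [wx ->]]]]; rewrite linear_sumlz big1 // => k _.
have [i /= ilt <-] := wx k; rewrite linearZl_LR linearBr /=.
by rewrite dot_head_proj // subrr mulr0.
Qed.

(** Since [orth_proj] is a choice with default [0], both existence and uniqueness must be shown. For
    uniqueness, the difference of two candidates lies in [V] and is orthogonal to [V], hence is
    orthogonal to itself. *)
Lemma orth_proj_complE n u :
  orth_proj ip (orth_compl ip (head_span x n)) u = u - head_proj n u.
Proof.
set V := orth_compl _ _.
have Vq v : V v -> ip v (u - (u - head_proj n u)) = 0.
  by move=> Vv; rewrite subKr dot_sym; apply: Vv; exact: head_proj_span.
apply: xget_unique; first by split => //; exact: sub_head_proj_orth.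
move=> p [Vp up]; apply/eqP; rewrite -subr_eq0; apply/eqP/dot_eq0.
set q := u - head_proj n u in Vq *.
have Vpq : V (p - q).
  by move=> w Ww; rewrite dotBr Vp // sub_head_proj_orth // subrr.
have pqE : p - q = (u - q) - (u - p) by move: (q) => r; rewrite opprB [RHS]addrC subrKA.
by rewrite [X in ip _ X]pqE dotBr Vq // up // subrr.
Qed.

(** The difference of the two squares is the squared length of [u - head_proj n u]. *)
Lemma bessel n u : norm_induced_by ip -> l2norm (head_coords n u) <= `|u|.
Proof.
move=> ->; apply: ler_wsqrtr; set q := u - head_proj n u.
have qq : 0 <= ip q q.
  have [->|/(neq0_dnorm_gt0 (s := ip))/ltW //] := eqVneq q 0.
  by rewrite linear0l.
have : ip q q = ip u u - \sum_(i < n) head_coords n u 0 i ^+ 2.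
  rewrite [in X in ip _ X]/q dotBr [ip q (head_proj n u)]dot_sym.
  rewrite sub_head_proj_orth ?subr0; last exact: head_proj_span.
  rewrite dotBl linear_sumlz; congr (_ - _); apply: eq_bigr => i _.
  by rewrite linearZl_LR /= expr2; congr (_ * _); rewrite mxE.
lra.
Qed.

End OrthogonalProjection.

(** * From the dual bound to the error estimate *)

Lemma pairing_le_dual_norm (R : realType) (B : normedModType R) (Y : lmodType R)
    (pB : {pairing B, Y}) (y : Y) (d : R) (z : B) :
  (dual_norm pB y <= d%:E)%E -> pB z y <= `|z| * d.
Proof.
move=> yd; have [->|z0] := eqVneq z 0; first by rewrite linear0l normr0 mul0r.
have nz : 0 < `|z| by rewrite normr_gt0.
rewrite -ler_pdivrMl // -lee_fin; apply: le_trans yd.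
apply: ereal_sup_ubound; exists (`|z|^-1 *: z) => /=; last by rewrite linearZl_LR.
by rewrite normrZ normfV normr_id mulVf // gt_eqF.
Qed.

Theorem corollary3p5 (R : realType)
  (X : completeNormedModType R) (C : lmodType R) (pX : {pairing X, C})
  (B : normedModType R) (Y : lmodType R) (pB : {pairing B, Y})
  (A : {linear X -> B}) (K : set B) (c : C) (b : B)
  (ip : {dot X for (idfun : R -> R)}) (x : nat -> X)
  (n : nat) (theta_P gamma J_LB : R) (xstar : X) (ystar : Y) :
  separating pX ->
  separating pB ->
  continuous (A : weak_space pX -> weak_space pB) ->
  convex_cone K ->
  @closed (weak_space pB) K ->
  norm_induced_by ip ->
  orthonormal_family ip x ->
  dense (lin_span (range x)) ->
  0 < theta_P ->
  P_optimizer pX A K c b xstar ->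
  Dn_optimizer pX pB A K c b x (@l2norm R n) theta_P ystar ->
  `|xstar| <= theta_P ->
  Pn_feasible A K b x (@l2norm R n) theta_P !=set0 ->
  0 < gamma ->
  (forall y, dual_cone pB K y ->
     (gamma%:E * dual_norm pB y
        <= (vdual_norm (@l2norm R n) (A_n_adj pB A x n y))%:E)%E) ->
  `|b| < gamma * theta_P ->
  let J := P_value pX A K c b in
  let Jn := Pn_value pX A K c b x (@l2norm R n) theta_P in
  (J_LB%:E <= Jn)%E ->
  let theta_D := (theta_P * vdual_norm (@l2norm R n) (c_vec pX c x n) - J_LB)
                 / (gamma * theta_P - `|b|) in
  let Xbar := orth_compl ip (head_span x n) in
  (0 <= Jn - J)%E /\
  (Jn - J <= (dual_norm_on pX Xbar c + theta_D%:E * op_norm_on A Xbar)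
             * `|orth_proj ip Xbar xstar|%:E)%E.
Proof.
move=> _ _ _ cK clK ip_norm x_orth _ theta0 [xfeas xJ] [ydual yopt] xtheta feas
  gamma0 gammaA bgamma J Jn JLB theta_D Xbar.
pose cv := c_vec pX c x n.
have JE : J = (pX xstar c)%:E by rewrite /J -xJ.
have pX_head (a : 'rV[R]_n) : pX (\sum_(i < n) a 0 i *: x i) c = vdot a cv.
  by rewrite linear_sumlz; apply: eq_bigr => i _; rewrite linearZl_LR mxE.
have A_head (a : 'rV[R]_n) : A (\sum_(i < n) a 0 i *: x i) = A_n A x a.
  by rewrite linear_sum; apply: eq_bigr => i _; rewrite linearZ.
have JJn : (J <= Jn)%E.
  apply: le_ereal_inf_tmp => _ [a [Ka _] <-]; apply: ereal_inf_lbound.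
  by exists (\sum_(i < n) a 0 i *: x i); rewrite /P_feasible /= ?A_head ?pX_head.
(* The real number [J] bounds [Jn] below and a feasible point bounds it above, so the difference can
   be treated in the reals. *)
have Jn_fin : Jn \is a fin_num.
  have [a0 a0feas] := feas; rewrite fin_numE; apply/andP; split.
    by apply: contraTN JJn => /eqP ->; rewrite JE.
  have : (Jn <= (vdot a0 cv)%:E)%E by apply: ereal_inf_lbound; exists a0.
  by apply: contraTN => /eqP ->.
move: JJn JLB; rewrite JE -(fineK Jn_fin); set jn := fine Jn; rewrite !lee_fin => JJn JLB.
rewrite -EFinB subr_ge0; split=> //.
set obj := Dn_objective pX pB A c b x (@l2norm R n) theta_P in yopt.
have jn_obj : jn <= obj ystar.
  (* The duality lemma needs a level strictly below all feasible values, so it is applied at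
     [jn - e] for arbitrary [e > 0]. *)
  apply/ler_addgt0Pl => e e0; rewrite -lerBlDl.
  have [a fa|y Ky] := @Dn_strong_duality R X B C Y pX pB A K c b x n theta_P
                        (jn - e) cK clK theta0 feas.
    rewrite ltrBlDr (@le_lt_trans _ _ (vdot a cv)) ?ltrDl //.
    by rewrite -lee_fin /jn fineK //; apply: ereal_inf_lbound; exists a.
  move=> /le_trans; apply; rewrite -lee_fin yopt.
  by apply: ereal_sup_ubound; exists y.
(* Coercivity excludes an infinite dual norm: multiplied by [gamma > 0], it would have to stay below
   a real number. *)
have [d0 dfin] : (0%:E <= dual_norm pB ystar)%E /\ dual_norm pB ystar \is a fin_num.
  have d0 : (0%:E <= dual_norm pB ystar)%E.
    by apply: ereal_sup_ubound; exists 0; rewrite /= ?normr0 ?linear0l.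
  split => //; rewrite ge0_fin_numE // ltey; apply: contraTN (gammaA _ ydual) => /eqP ->.
  by rewrite gt0_muley ?lte_fin.
set d := fine (dual_norm pB ystar).
have dE : dual_norm pB ystar = d%:E by rewrite /d fineK.
have {d0} d0 : 0 <= d by rewrite -lee_fin -dE.
have gd : gamma * d <= vdual_norm (@l2norm R n) (A_n_adj pB A x n ystar).
  by have := gammaA _ ydual; rewrite dE -EFinM lee_fin.
have ystar_le z : pB z ystar <= `|z| * d by apply: pairing_le_dual_norm; rewrite dE.
(* Coercivity and the triangle inequality bound [gamma * d] by [N1 + N2], while
   [J_LB <= jn <= obj ystar] bounds [theta_P * N1] by [|b| * d - J_LB]. Eliminating [N1] gives the
   denominator of [theta_D]. *)
have dtheta : d <= theta_D.
  rewrite /theta_D -/cv ler_pdivlMr ?subr_gt0 //.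
  have := vdual_normB (A_n_adj pB A x n ystar) cv.
  have := ystar_le b.
  move: jn_obj; rewrite /obj /Dn_objective -/cv.
  set N1 := vdual_norm _ (_ - _); set N2 := vdual_norm _ cv => h1 h2 h3.
  have h4 : theta_P * (gamma * d) <= theta_P * (N1 + N2).
    by rewrite ler_pM2l //; exact: le_trans gd h3.
  lra.
pose a := head_coords ip x n xstar; pose q := xstar - head_proj ip x n xstar.
have projE : orth_proj ip Xbar xstar = q by exact: orth_proj_complE.
have Vq : Xbar q by exact: sub_head_proj_orth.
have atheta : l2norm a <= theta_P by apply: le_trans xtheta; exact: bessel.
(* The coordinates [a] are only known to lie in the ball, so they are compared with [jn] through the
   dual objective: [h1] replaces the norm term by its value at [a], and [h2] bounds [pB b ystar] by
   [pB (A xstar) ystar]. *)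
have gap : jn - pX xstar c <= pX (- q) c + theta_D * `|A q|.
  have h1 := vdot_le_vdual_norm theta_P a (A_n_adj pB A x n ystar - cv) theta0 atheta.
  rewrite vdotBr -pairing_A_n -A_head -pX_head -/(head_proj ip x n xstar) in h1.
  have h2 := ydual _ xfeas; rewrite linearBl in h2.
  have h3 := ystar_le (A q).
  have h4 : `|A q| * d <= theta_D * `|A q| by rewrite mulrC ler_wpM2r.
  have h5 : pB (A q) ystar = pB (A xstar) ystar - pB (A (head_proj ip x n xstar)) ystar.
    by rewrite linearB linearBl.
  have h6 : pX (- q) c = pX (head_proj ip x n xstar) c - pX xstar c.
    by rewrite opprB linearBl.
  move: jn_obj; rewrite /obj /Dn_objective -/cv; lra.
rewrite projE; have [q0|q0] := eqVneq q 0.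
  move: gap; rewrite q0 normr0 mule0 oppr0 linear0 linear0l normr0 mulr0 addr0.
  by rewrite lee_fin.
have nq : 0 < `|q| by rewrite normr_gt0.
(* The gap contains [- pX q c], so the witness is [- q], which also lies in the complement. *)
have cq : ((pX (- q) c / `|q|)%:E <= dual_norm_on pX Xbar c)%E.
  apply: ereal_sup_ubound; exists (- q); rewrite ?normrN //.
  split; first by move=> v Vv; rewrite linearNr /= Vq // oppr0.
  by move/eqP; rewrite oppr_eq0 (negbTE q0).
have Aq : ((`|A q| / `|q|)%:E <= op_norm_on A Xbar)%E.
  by apply: ereal_sup_ubound; exists q => //; split => //; exact/eqP.
apply: (@le_trans _ _ (((pX (- q) c / `|q|)%:E + theta_D%:E * (`|A q| / `|q|)%:E)
                        * `|q|%:E)%E).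
  by rewrite -EFinM lee_fin mulrDl divfK ?gt_eqF // mulrA divfK ?gt_eqF.
apply: lee_wpmul2r; first by rewrite lee_fin.
by apply: leeD => //; apply: lee_wpmul2l => //; rewrite lee_fin (le_trans d0).
Qed.
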